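(* Let $n\ge 1$ and let $\theta_1,\theta_2,\theta_3,\kappa_0,\kappa_1,\ldots,\kappa_n,\rho_1,\ldots,\rho_n$ be complex parameters. Let $q_j,p_j,q'_j,p'_j$ ($j=1,\ldots,n$) be (locally holomorphic) functions of $(t_1,t_2)$ solving the Schlesinger–Tsuda system $\mathcal{H}_{n+1,2}$ \[ \frac{\partial q_j}{\partial t_i}=\frac{\partial H_i}{\partial p_j},\quad \frac{\partial p_j}{\partial t_i}=-\frac{\partial H_i}{\partial q_j},\quad \frac{\partial q'_j}{\partial t_i}=\frac{\partial H_i}{\partial p'_j},\quad \frac{\partial p'_j}{\partial t_i}=-\frac{\partial H_i}{\partial q'_j}\qquad(i=1,2;\ j=1,\ldots,n), \] with Hamiltonians $H_1,H_2$ as described in the context. Assume moreover that \[ q_ip_i-\kappa_i-\rho_i=0,\qquad p'_i=0\qquad(i=1,\ldots,n),\qquad \theta_1+\sum_{j=1}^n(\kappa_j+\rho_j)=0 . \] Let $w_0$ be a nonzero function satisfying \[ d\log w_0=\Big(\sum_{j=1}^np_j+\theta_3\Big)d\log(t_1-1)+\Big\{\sum_{j=1}^n(q'_j-1)p_j+\kappa_0+\rho_1\Big\}d\log t_1+\Big(-\sum_{j=1}^nq'_jp_j+\theta_2\Big)d\log(t_1-t_2), \] where $d$ is the exterior derivative in $(t_1,t_2)$, and put $w_i=p_iw_0$, $w'_i=-q'_ip_iw_0$ ($i=1,\ldots,n$). Then the vector $\mathbf{w}={}^t[w_0,w_1,\ldots,w_n,w'_1,\ldots,w'_n]$ satisfies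 the linear Pfaff system \[ d\mathbf{w}=\{A_1^{(1)}d\log(t_1-1)+A_0^{(1)}d\log t_1+A_td\log(t_1-t_2)+A_1^{(2)}d\log(t_2-1)+A_0^{(2)}d\log t_2\}\mathbf{w}, \] where, indexing rows and columns by $0,1,\ldots,2n$ (index $i\in\{1,\dots,n\}$ corresponding to $w_i$ and index $n+i$ to $w'_i$) and letting $E_{i,j}$ denote the $(2n+1)\times(2n+1)$ matrix with $1$ in entry $(i,j)$ and $0$ elsewhere, \begin{align*} A_1^{(1)}&=\theta_3E_{0,0}+\sum_{j=1}^nE_{0,j}+\sum_{i=1}^n\Big\{\theta_3(\kappa_i+\rho_i)E_{i,0}+\sum_{j=1}^n(\kappa_i+\rho_i)E_{i,j}\Big\},\\ A_0^{(1)}&=(\kappa_0+\rho_1)E_{0,0}-\sum_{j=1}^nE_{0,j}-\sum_{j=1}^nE_{0,n+j}+\sum_{i=1}^n\Big\{(\rho_1-\rho_i)E_{i,i}-\sum_{j=i+1}^n(\kappa_i+\rho_i)E_{i,j}\Big\}\\ &\quad+\sum_{i=1}^n\Big\{(\rho_1-\rho_i)E_{n+i,n+i}-\sum_{j=i+1}^n(\kappa_i+\rho_i)E_{n+i,n+j}\Big\},\\ A_t&=\theta_2E_{0,0}+\sum_{j=1}^nE_{0,n+j}+\sum_{i=1}^n\Big\{\theta_2(\kappa_i+\rho_i)E_{n+i,0}+\sum_{j=1}^n(\kappa_i+\rho_i)E_{n+i,n+j}\Big\},\\ A_1^{(2)}&=\sum_{i=1}^n\{\theta_2E_{i,i}-\theta_3E_{i,n+i}\}+\sum_{i=1}^n\{-\theta_2E_{n+i,i}+\theta_3E_{n+i,n+i}\},\\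 A_0^{(2)}&=\sum_{i=1}^n\Big\{-\theta_2(\kappa_i+\rho_i)E_{n+i,0}+\theta_2E_{n+i,i}-\sum_{j=1}^{i-1}(\kappa_i+\rho_i)E_{n+i,n+j}+(\theta_2+\kappa_0-\kappa_i)E_{n+i,n+i}\Big\}. \end{align*}
   Context: The Hamiltonian $H_1$ is \[ H_1=\frac{H_1^{(t)}}{t_1-t_2}+\frac{H_1^{(1)}}{t_1-1}+\frac{H_1^{(0)}}{t_1}, \] where \begin{align*} H_1^{(t)}&=\Big\{\sum_{i=1}^nq_i(p_i-p'_i)+\theta_1\Big\}\Big\{\sum_{i=1}^nq'_i(p'_i-p_i)+\theta_2\Big\},\\ H_1^{(1)}&=\Big[\sum_{i=1}^n\{(q_i-1)p_i+q'_ip'_i-\kappa_i-\rho_i\}-\theta_3\Big]\Big[\sum_{i=1}^nq_i\{(q_i-1)p_i+q'_ip'_i-\kappa_i-\rho_i\}-\theta_1\Big],\\ H_1^{(0)}&=\Big(\sum_{i=1}^nq_ip_i+\theta_1\Big)\Big\{\sum_{i=1}^n(q_i+q'_i-1)p_i+\kappa_0\Big\}-\sum_{i=1}^n\kappa_iq_ip_i\\ &\quad+\sum_{i=1}^n\sum_{j=i+1}^nq_ip_j\{(q_i-q_j)p_i+(q'_i-q'_j)p'_i-\kappa_i-\rho_i\}. \end{align*} The Hamiltonian $H_2$ is obtained from $H_1$ by the simultaneous replacement $t_1\leftrightarrow t_2$, $p_i\leftrightarrow p'_i$, $q_i\leftrightarrow q'_i$ ($i=1,\dots,n$), $\theta_1\leftrightarrow\theta_2$.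 *)

(* Defs.v *)
From HB Require Import structures.
From mathcomp Require Import all_boot all_order all_algebra.
From mathcomp Require Import all_classical all_reals topology normedtype derive.
From mathcomp Require Import complex.
Set Implicit Arguments. Unset Strict Implicit. Unset Printing Implicit Defensive.
Import Order.TTheory GRing.Theory Num.Theory.
Import numFieldNormedType.Exports.
Local Open Scope ring_scope.
Local Open Scope complex_scope.

Section Defs.
Variable R : realType.
Local Notation C := (R[i])^o.

Definition upd N (v : 'I_N -> C) (j : 'I_N) (x : C) : 'I_N -> C :=
  fun k => if k == j then x else v k.

(* The Hamiltonian H_1 (indices 1..n of the paper are 0..N-1 here) *)
Definition Ham1 N (th1 th2 th3 k0 : C) (k rho : 'I_N -> C)
    (t1 t2 : C) (q p q' p' : 'I_N -> C) : C :=
  let Ht := (\sum_(i < N) q i * (p i - p' i) + th1) *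
            (\sum_(i < N) q' i * (p' i - p i) + th2) in
  let H1 := (\sum_(i < N) ((q i - 1) * p i + q' i * p' i - k i - rho i) - th3) *
            (\sum_(i < N) q i * ((q i - 1) * p i + q' i * p' i - k i - rho i) - th1) in
  let H0 := (\sum_(i < N) q i * p i + th1) *
              (\sum_(i < N) (q i + q' i - 1) * p i + k0)
            - \sum_(i < N) k i * q i * p i
            + \sum_(i < N) \sum_(j < N | (i < j)%N)
                q i * p j * ((q i - q j) * p i + (q' i - q' j) * p' i - k i - rho i) in
  Ht / (t1 - t2) + H1 / (t1 - 1) + H0 / t1.

Definition Ham2 N (th1 th2 th3 k0 : C) (k rho : 'I_N -> C)
    (t1 t2 : C) (q p q' p' : 'I_N -> C) : C :=
  Ham1 th2 th1 th3 k0 k rho t2 t1 q' p' q p.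

Definition dHdq N (H : ('I_N -> C) -> ('I_N -> C) -> ('I_N -> C) -> ('I_N -> C) -> C)
  q p q' p' j : C := derive1 (fun x => H (upd q j x) p q' p') (q j).
Definition dHdp N (H : ('I_N -> C) -> ('I_N -> C) -> ('I_N -> C) -> ('I_N -> C) -> C)
  q p q' p' j : C := derive1 (fun x => H q (upd p j x) q' p') (p j).
Definition dHdq' N (H : ('I_N -> C) -> ('I_N -> C) -> ('I_N -> C) -> ('I_N -> C) -> C)
  q p q' p' j : C := derive1 (fun x => H q p (upd q' j x) p') (q' j).
Definition dHdp' N (H : ('I_N -> C) -> ('I_N -> C) -> ('I_N -> C) -> ('I_N -> C) -> C)
  q p q' p' j : C := derive1 (fun x => H q p q' (upd p' j x)) (p' j).

Definition d1 (f : C -> C -> C) (t1 t2 : C) : C := derive1 (fun s => f s t2) t1.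
Definition d2 (f : C -> C -> C) (t1 t2 : C) : C := derive1 (fun s => f t1 s) t2.
Definition pderivable (f : C -> C -> C) (t1 t2 : C) : Prop :=
  derivable (fun s => f s t2) t1 1 /\ derivable (fun s => f t1 s) t2 1.

Definition ix0 N : 'I_(N.*2.+1) := ord0.
Definition ixw N (i : 'I_N) : 'I_(N.*2.+1) := inord i.+1.
Definition ixw' N (i : 'I_N) : 'I_(N.*2.+1) := inord (N + i.+1).
Definition E N (a b : 'I_(N.*2.+1)) : 'M[C]_(N.*2.+1) := delta_mx a b.

Section Mats.
Variables (N : nat) (th2 th3 k0 : C) (k rho : 'I_N.+1 -> C).
Local Notation M := 'M[C]_((N.+1).*2.+1).
Local Notation "'E0'" := (ix0 N.+1).
Local Notation w := (@ixw N.+1).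
Local Notation w' := (@ixw' N.+1).
Local Notation EE := (@E N.+1).
Local Notation rho1 := (rho ord0).

Definition A11 : M :=
  th3 *: EE E0 E0 + \sum_(j < N.+1) EE E0 (w j)
  + \sum_(i < N.+1) (th3 * (k i + rho i) *: EE (w i) E0
                     + \sum_(j < N.+1) (k i + rho i) *: EE (w i) (w j)).

Definition A01 : M :=
  (k0 + rho1) *: EE E0 E0 - \sum_(j < N.+1) EE E0 (w j) - \sum_(j < N.+1) EE E0 (w' j)
  + \sum_(i < N.+1) ((rho1 - rho i) *: EE (w i) (w i)
        - \sum_(j < N.+1 | (i < j)%N) (k i + rho i) *: EE (w i) (w j))
  + \sum_(i < N.+1) ((rho1 - rho i) *: EE (w' i) (w' i)
        - \sum_(j < N.+1 | (i < j)%N) (k i + rho i) *: EE (w' i) (w' j)).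

Definition At : M :=
  th2 *: EE E0 E0 + \sum_(j < N.+1) EE E0 (w' j)
  + \sum_(i < N.+1) (th2 * (k i + rho i) *: EE (w' i) E0
                     + \sum_(j < N.+1) (k i + rho i) *: EE (w' i) (w' j)).

Definition A12 : M :=
  \sum_(i < N.+1) (th2 *: EE (w i) (w i) - th3 *: EE (w i) (w' i))
  + \sum_(i < N.+1) (- th2 *: EE (w' i) (w i) + th3 *: EE (w' i) (w' i)).

Definition A02 : M :=
  \sum_(i < N.+1) (- (th2 * (k i + rho i)) *: EE (w' i) E0 + th2 *: EE (w' i) (w i)
       - \sum_(j < N.+1 | (j < i)%N) (k i + rho i) *: EE (w' i) (w' j)
       + (th2 + k0 - k i) *: EE (w' i) (w' i)).
End Mats.

Definition atv N (f : 'I_N -> C -> C -> C) (t1 t2 : C) : 'I_N -> C :=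
  fun j => f j t1 t2.

Definition wvec N (w0 : C -> C -> C) (p q' : 'I_N -> C -> C -> C) (t1 t2 : C)
  : 'cV[C]_(N.*2.+1) :=
  w0 t1 t2 *: (delta_mx (ix0 N) 0
     + \sum_(i < N) p i t1 t2 *: delta_mx (ixw i) 0
     + \sum_(i < N) (- (q' i t1 t2 * p i t1 t2)) *: delta_mx (ixw' i) 0).
End Defs.

(* Main.v *)
(* Under the constraints q_i p_i = kappa_i + rho_i and p'_i = 0, the condition
   theta_1 + sum (kappa_j + rho_j) = 0 kills the factors sum q_i (p_i - p'_i) +
   theta_1 and sum q_i p_i + theta_1 and the second factor of H_1^(1). What
   remains makes dp_i + p_i d log w_0 and d(q'_i p_i) + q'_i p_i d log w_0
   affine in the p_j and q'_j p_j: the quadratic terms cancel against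
   d log w_0. Multiplying by w_0 gives the linear system. *)
Require Import Defs.
From HB Require Import structures.
From mathcomp Require Import all_boot all_order all_algebra.
From mathcomp Require Import all_classical all_reals topology normedtype derive.
From mathcomp Require Import complex ring zify.
Import Order.TTheory GRing.Theory Num.Theory.
Import numFieldNormedType.Exports.
Local Open Scope ring_scope.
Local Open Scope classical_set_scope.

(** * Derivative rules for functions written pointwise, including finite sums *)

Section PointwiseRules.
Context {K : numFieldType}.
Implicit Types (f g : K^o -> K^o) (x : K^o).

Lemma is_derive_cstf (c : K^o) x : is_derive x 1 (fun=> c) 0.
Proof. exact: is_derive_cst. Qed.

Lemma is_derive_addf {f g x} {df dg : K^o} :
  is_derive x 1 f df -> is_derive x 1 g dg ->
  is_derive x 1 (fun y => f y + g y) (df + dg).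
Proof. by move=> *; exact: is_deriveD. Qed.

Lemma is_derive_oppf {f x} {df : K^o} :
  is_derive x 1 f df -> is_derive x 1 (fun y => - f y) (- df).
Proof. by move=> *; exact: is_deriveN. Qed.

Lemma is_derive_mulf {f g x} {df dg : K^o} :
  is_derive x 1 f df -> is_derive x 1 g dg ->
  is_derive x 1 (fun y => f y * g y) (f x * dg + g x * df).
Proof. by move=> *; exact: is_deriveM. Qed.

Lemma is_derive_sumf N (P : pred 'I_N) (f : 'I_N -> K^o -> K^o) x
    (df : 'I_N -> K^o) :
  (forall i, P i -> is_derive x 1 (f i) (df i)) ->
  is_derive x 1 (fun y => \sum_(i < N | P i) f i y) (\sum_(i < N | P i) df i).
Proof.
move=> fdf; under eq_fun do rewrite big_mkcond; rewrite big_mkcond /=.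
have -> : (fun y => \sum_i (if P i then f i y else 0))
    = \sum_i (fun y => if P i then f i y else 0 : K^o).
  by apply/funext => y; rewrite fct_sumE.
apply: is_derive_sum => i; case: ifPn => Pi; first exact: fdf.
exact: is_derive_cst.
Qed.

(** When a single coordinate [j] moves, every other summand is frozen at its value at [x], so the
    sum is [f j] plus a constant. *)
Lemma is_derive_sum1 {N} (j : 'I_N) {f : 'I_N -> K^o -> K^o} {x df} :
  (forall i y, i != j -> f i y = f i x) -> is_derive x 1 (f j) df ->
  is_derive x 1 (fun y => \sum_(i < N) f i y) df.
Proof.
move=> fcst fj.
have -> : (fun y => \sum_i f i y)
    = (fun y => f j y + \sum_(i < N | i != j) f i x).
  apply/funext => y; rewrite (bigD1 j) //=; congr (_ + _).
  by apply: eq_bigr => i; exact: fcst.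
by apply: is_derive_eq (is_derive_addf fj (is_derive_cstf _ _)) _;
  rewrite addr0.
Qed.

(** The strict inequality excludes the diagonal, so a pair containing [j] contains it exactly once:
    [da] collects the pairs with [j] on the left, [db] those with [j] on the right, and all other
    pairs are constant. *)
Lemma is_derive_dsum1 {N} (j : 'I_N) {f : 'I_N -> 'I_N -> K^o -> K^o} {x}
    {da db : 'I_N -> K^o} :
  (forall i l y, i != j -> l != j -> f i l y = f i l x) ->
  (forall l, l != j -> is_derive x 1 (f j l) (da l)) ->
  (forall i, i != j -> is_derive x 1 (f i j) (db i)) ->
  is_derive x 1 (fun y => \sum_(i < N) \sum_(l < N | (i < l)%N) f i l y)
    (\sum_(l < N | (j < l)%N) da l + \sum_(i < N | (i < j)%N) db i).
Proof.
move=> fcst fa fb.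
(* The claimed derivative is spread over the whole triangle, with zeros off row and column [j], so
   that it can be matched term by term. *)
have -> : \sum_(l < N | (j < l)%N) da l + \sum_(i < N | (i < j)%N) db i =
    \sum_(i < N) \sum_(l < N | (i < l)%N)
      (if i == j then da l else if l == j then db i else 0).
  rewrite [RHS](bigD1 j) //=; congr (_ + _); first by rewrite eqxx.
  rewrite big_mkcond [RHS]big_mkcond; apply: eq_bigr => i _ /=.
  have [->|ij] := eqVneq i j; first by rewrite ltnn.
  case: ifPn => lij.
    rewrite (bigD1 j) //= eqxx big1 ?addr0 // => l /andP[_ /negbTE ->] //.
  rewrite big1 // => l il; case: eqP => // lj.
  by rewrite -lj il in lij.
apply: is_derive_sumf => i _; apply: is_derive_sumf => l il.
case: eqVneq => [ij|ij].
  by subst i; apply: fa; apply/eqP => lj; rewrite lj ltnn in il.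
case: eqVneq => [lj|lj]; first by subst l; exact: fb.
have -> : f i l = fun=> f i l x by apply/funext => y; exact: fcst.
exact: is_derive_cstf.
Qed.

End PointwiseRules.

(** * Partial derivatives of the Hamiltonians *)

Section Partials.
Variable R : realType.
Local Notation C := (R[i])^o.
Local Notation D1 x f df := (is_derive (x : C) (1 : C) (f : C -> C) (df : C)).
Variable N : nat.
Implicit Types (v q p k rho : 'I_N -> C) (th t : C).

Lemma upd_id v j : upd v j (v j) = v.
Proof. by apply/funext => i; rewrite /upd; case: eqP => [->|]. Qed.

Lemma is_derive_upd v j i (x : C) : D1 x (fun y => upd v j y i) (i == j)%:R.
Proof.
rewrite /upd; case: eqP => _; first exact: is_derive_id.
exact: is_derive_cst.
Qed.

(* The sums in [Ham1], without the constants theta_i and kappa_0 added to them;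
   both factors of H_1^(t) come from [sumA], the second as [sumA q' p' p]. *)
Definition sumA q p (p' : 'I_N -> C) : C := \sum_(i < N) q i * (p i - p' i).
Definition sumS k rho q p (q' p' : 'I_N -> C) : C :=
  \sum_(i < N) ((q i - 1) * p i + q' i * p' i - k i - rho i).
Definition sumT k rho q p (q' p' : 'I_N -> C) : C :=
  \sum_(i < N) q i * ((q i - 1) * p i + q' i * p' i - k i - rho i).
Definition sumC q p : C := \sum_(i < N) q i * p i.
Definition sumF q p (q' : 'I_N -> C) : C := \sum_(i < N) (q i + q' i - 1) * p i.
Definition sumK k q p : C := \sum_(i < N) k i * q i * p i.
Definition sumD k rho q p (q' p' : 'I_N -> C) : C :=
  \sum_(i < N) \sum_(l < N | (i < l)%N)
    q i * p l * ((q i - q l) * p i + (q' i - q' l) * p' i - k i - rho i).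

(** The product rule applied to [Ham1], with the derivatives of the eight sums as parameters: one
    formula serves all four kinds of coordinates. *)
Definition dHam1 th1 th2 th3 (k0 : C) k rho t1 t2
    q p (q' p' : 'I_N -> C) (dA dB dS dT dC dF dK dD : C) : C :=
  (dA * (sumA q' p' p + th2) + (sumA q p p' + th1) * dB) / (t1 - t2)
  + (dS * (sumT k rho q p q' p' - th1) + (sumS k rho q p q' p' - th3) * dT)
      / (t1 - 1)
  + (dC * (sumF q p q' + k0) + (sumC q p + th1) * dF - dK + dD) / t1.

(** Only the eight sums vary with [y]; each division is a product with a constant inverse, so the
    sum and product rules suffice. All four families may depend on [y], which makes every partial
    derivative an instance. *)
Lemma is_derive_Ham1 th1 th2 th3 (k0 : C) k rho t1 t2
    (q p q' p' : C -> 'I_N -> C) x dA dB dS dT dC dF dK dD :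
  D1 x (fun y => sumA (q y) (p y) (p' y)) dA ->
  D1 x (fun y => sumA (q' y) (p' y) (p y)) dB ->
  D1 x (fun y => sumS k rho (q y) (p y) (q' y) (p' y)) dS ->
  D1 x (fun y => sumT k rho (q y) (p y) (q' y) (p' y)) dT ->
  D1 x (fun y => sumC (q y) (p y)) dC ->
  D1 x (fun y => sumF (q y) (p y) (q' y)) dF ->
  D1 x (fun y => sumK k (q y) (p y)) dK ->
  D1 x (fun y => sumD k rho (q y) (p y) (q' y) (p' y)) dD ->
  derive1 (fun y : C => Ham1 th1 th2 th3 k0 k rho t1 t2
      (q y) (p y) (q' y) (p' y)) x
  = dHam1 th1 th2 th3 k0 k rho t1 t2 (q x) (p x) (q' x) (p' x)
      dA dB dS dT dC dF dK dD.
Proof.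
move=> hA hB hS hT hC hF hK hD.
have c := fun z : C => is_derive_cstf z x.
have Dval := is_derive_addf (is_derive_addf
   (is_derive_mulf (is_derive_mulf (is_derive_addf hA (c th1))
                                   (is_derive_addf hB (c th2))) (c (t1 - t2)^-1))
   (is_derive_mulf (is_derive_mulf (is_derive_addf hS (c (- th3)))
                                   (is_derive_addf hT (c (- th1)))) (c (t1 - 1)^-1)))
   (is_derive_mulf (is_derive_addf (is_derive_addf
      (is_derive_mulf (is_derive_addf hC (c th1)) (is_derive_addf hF (c k0)))
      (is_derive_oppf hK)) hD) (c t1^-1)).
rewrite derive1E /Ham1 (@derive_val _ _ _ _ _ _ _ Dval) /dHam1.
ring.
Qed.

(* [is_derive] is a type class: plain [apply] would start an instance search
   on every subgoal. *)
Ltac derive_poly :=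
  lazymatch goal with
  | |- is_derive _ _ (fun=> ?c) _ => notypeclasses refine (is_derive_cstf _ _)
  | |- is_derive _ _ (fun y => upd _ _ y _) _ =>
      notypeclasses refine (is_derive_upd _ _ _ _)
  | |- is_derive _ _ (fun y => @?f y + @?g y) _ =>
      notypeclasses refine (@is_derive_addf _ f g _ _ _ _ _); derive_poly
  | |- is_derive _ _ (fun y => @?f y * @?g y) _ =>
      notypeclasses refine (@is_derive_mulf _ f g _ _ _ _ _); derive_poly
  | |- is_derive _ _ (fun y => - @?f y) _ =>
      notypeclasses refine (@is_derive_oppf _ f _ _ _); derive_poly
  end.

Ltac derive_summand :=
  notypeclasses refine (is_derive_eq _ _);
    [derive_poly
    | rewrite /= ?upd_id ?eqxx;
      try match goal with H : (_ == _) = false |- _ => rewrite ?H end;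
      rewrite ?mulr1n ?mulr0n; ring].

Ltac derive_Ham1 j :=
  rewrite ?upd_id /sumA /sumS /sumT /sumC /sumF /sumK /sumD;
  lazymatch goal with
  | |- is_derive _ _ (fun=> ?c) _ => notypeclasses refine (is_derive_cstf _ _)
  | |- is_derive _ _ (fun y => \sum_i \sum_(l | _) _) _ =>
      notypeclasses refine (is_derive_dsum1 j _ _ _);
      [by move=> ? ? ? /negbTE + /negbTE; rewrite /upd => -> // ->
      | move=> ? /negbTE; intro; derive_summand ..]
  | |- is_derive _ _ (fun y => \sum_i _) _ =>
      notypeclasses refine (is_derive_sum1 j _ _);
      [by move=> ? ? /negbTE; rewrite /upd => -> | derive_summand]
  end.

(** In the double sum, for [l] above [j] the variable [q j] sits both in the prefactor and in the
    difference; for [i] below [j] it sits only in the difference. *)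
Lemma dHam1_dq th1 th2 th3 (k0 : C) k rho t1 t2 q p
    (q' p' : 'I_N -> C) j :
  derive1 (fun y : C => Ham1 th1 th2 th3 k0 k rho t1 t2
      (upd q j y) p q' p') (q j) =
  dHam1 th1 th2 th3 k0 k rho t1 t2 q p q' p'
    (p j - p' j) 0 (p j)
    ((q j - 1) * p j + q' j * p' j - k j - rho j + q j * p j)
    (p j) (p j) (k j * p j)
    (\sum_(l < N | (j < l)%N)
        p l * ((q j - q l) * p j + (q' j - q' l) * p' j - k j - rho j + q j * p j)
     + \sum_(i < N | (i < j)%N) - (q i * p j * p i)).
Proof.
(* Reading [q] as [upd q j (q j)] displays the moving family at the point of differentiation. *)
rewrite -[in RHS](upd_id q j).
by apply: (is_derive_Ham1 _ _ _ _ _ _ _ _ (fun y => upd q j y)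
  (fun=> p) (fun=> q') (fun=> p')); derive_Ham1 j.
Qed.

Lemma dHam1_dp th1 th2 th3 (k0 : C) k rho t1 t2 q p
    (q' p' : 'I_N -> C) j :
  derive1 (fun y : C => Ham1 th1 th2 th3 k0 k rho t1 t2
      q (upd p j y) q' p') (p j) =
  dHam1 th1 th2 th3 k0 k rho t1 t2 q p q' p'
    (q j) (- q' j) (q j - 1) (q j * (q j - 1)) (q j) (q j + q' j - 1) (k j * q j)
    (\sum_(l < N | (j < l)%N) q j * p l * (q j - q l)
     + \sum_(i < N | (i < j)%N)
         q i * ((q i - q j) * p i + (q' i - q' j) * p' i - k i - rho i)).
Proof.
rewrite -[in RHS](upd_id p j).
by apply: (is_derive_Ham1 _ _ _ _ _ _ _ _ (fun=> q) (fun y => upd p j y)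
  (fun=> q') (fun=> p')); derive_Ham1 j.
Qed.

Lemma dHam1_dq' th1 th2 th3 (k0 : C) k rho t1 t2 q p
    (q' p' : 'I_N -> C) j :
  derive1 (fun y : C => Ham1 th1 th2 th3 k0 k rho t1 t2
      q p (upd q' j y) p') (q' j) =
  dHam1 th1 th2 th3 k0 k rho t1 t2 q p q' p'
    0 (p' j - p j) (p' j) (q j * p' j) 0 (p j) 0
    (\sum_(l < N | (j < l)%N) q j * p l * p' j
     + \sum_(i < N | (i < j)%N) - (q i * p j * p' i)).
Proof.
rewrite -[in RHS](upd_id q' j).
by apply: (is_derive_Ham1 _ _ _ _ _ _ _ _ (fun=> q) (fun=> p)
  (fun y => upd q' j y) (fun=> p')); derive_Ham1 j.
Qed.

Lemma dHam1_dp' th1 th2 th3 (k0 : C) k rho t1 t2 q p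
    (q' p' : 'I_N -> C) j :
  derive1 (fun y : C => Ham1 th1 th2 th3 k0 k rho t1 t2
      q p q' (upd p' j y)) (p' j) =
  dHam1 th1 th2 th3 k0 k rho t1 t2 q p q' p'
    (- q j) (q' j) (q' j) (q j * q' j) 0 0 0
    (\sum_(l < N | (j < l)%N) q j * p l * (q' j - q' l) + \sum_(i < N | (i < j)%N) 0).
Proof.
rewrite -[in RHS](upd_id p' j).
by apply: (is_derive_Ham1 _ _ _ _ _ _ _ _ (fun=> q) (fun=> p)
  (fun=> q') (fun y => upd p' j y)); derive_Ham1 j.
Qed.

(** Serves to split $\sum_i(\kappa_i+\rho_i)=-\theta_1$ at [j], matching the two halves of the
    differentiated double sum. *)
Lemma big_ord_trichotomy {V : nmodType} (F : 'I_N -> V) (j : 'I_N) :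
  \sum_(i < N) F i =
  \sum_(i < N | (i < j)%N) F i + F j + \sum_(l < N | (j < l)%N) F l.
Proof.
rewrite (bigD1 j) //= [X in F j + X](bigID (fun i : 'I_N => (i < j)%N)) /=.
rewrite addrA [F j + _]addrC; congr (_ + _ + _).
  by apply: eq_bigl => i; rewrite -val_eqE /= ltn_neqAle; case: eqP.
by apply: eq_bigl => i; rewrite -leqNgt [in RHS]ltn_neqAle eq_sym.
Qed.

(** * Partial derivatives on the locus cut out by the constraints *)

Section Constrained.
Variables (th1 th2 th3 k0 : C) (k rho q p q' p' : 'I_N -> C) (t1 t2 : C).
Hypothesis qpE : forall i, q i * p i = k i + rho i.
Hypothesis p'0 : forall i, p' i = 0.
Hypothesis th1E : th1 + \sum_(i < N) (k i + rho i) = 0.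

Let sumkr : \sum_(i < N) (k i + rho i) = - th1.
Proof. by apply/eqP; rewrite eq_sym eqr_oppLR -addr_eq0 th1E. Qed.

Let sumB : sumA q' p' p = - \sum_(i < N) q' i * p i.
Proof.
by rewrite /sumA -sumrN; apply: eq_bigr => i _; rewrite p'0 sub0r mulrN.
Qed.

Let sumA_th1 : sumA q p p' + th1 = 0.
Proof.
rewrite /sumA -[RHS]th1E addrC; congr (_ + _).
by apply: eq_bigr => i _; rewrite p'0 subr0 qpE.
Qed.

(** The product [q i * p i] cancels against [k i + rho i]. This is the origin of the coefficient
    $\sum_j p_j+\theta_3$ of $d\log(t_1-1)$ in $d\log w_0$. *)
Let H1e i : (q i - 1) * p i + q' i * p' i - k i - rho i = - p i.
Proof. by rewrite mulrBl qpE p'0; ring. Qed.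

Let H1S : sumS k rho q p q' p' = - \sum_(i < N) p i.
Proof. by rewrite /sumS -sumrN; apply: eq_bigr. Qed.

Let H1T : sumT k rho q p q' p' - th1 = 0.
Proof.
rewrite /sumT -[- th1]sumkr -big_split big1 // => i _ /=.
by rewrite H1e -qpE; ring.
Qed.

Let H1C : sumC q p + th1 = 0.
Proof. by rewrite /sumC -[RHS]th1E addrC; congr (_ + _); apply: eq_bigr. Qed.

Let H1F : sumF q p q' = - th1 + \sum_(i < N) (q' i - 1) * p i.
Proof.
rewrite /sumF -sumkr -big_split; apply: eq_bigr => i _ /=.
by rewrite -qpE; ring.
Qed.

(** Three factors vanish, so in each product only their own derivative survives. In the residue at
    $t_1=0$, the term $-\theta_1$ of [sumF] is split at [j]: its parts below and above [j] cancel
    against the double sum, and the part at [j] combines with $-\kappa_j p_j$ to leave $\rho_j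
    p_j$. *)
Lemma dHam1_dq_constrained j :
  derive1 (fun y : C => Ham1 th1 th2 th3 k0 k rho t1 t2
      (upd q j y) p q' p') (q j) =
  p j * (- (\sum_(i < N) q' i * p i) + th2) / (t1 - t2)
  + (\sum_(i < N) p i + th3) * (p j - (k j + rho j)) / (t1 - 1)
  + (p j * (\sum_(i < N) (q' i - 1) * p i + k0 + rho j)
     + (k j + rho j) * \sum_(l < N | (j < l)%N) p l) / t1.
Proof.
rewrite dHam1_dq /dHam1 sumB sumA_th1 H1S H1T H1C H1F p'0.
have th1j := big_ord_trichotomy (fun i => k i + rho i) j.
rewrite sumkr /= in th1j.
have -> : \sum_(l < N | (j < l)%N)
      p l * ((q j - q l) * p j + (q' j - q' l) * 0 - k j - rho j + q j * p j)
    = (k j + rho j) * \sum_(l < N | (j < l)%N) p l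
      - p j * \sum_(l < N | (j < l)%N) (k l + rho l).
  rewrite !mulr_sumr -sumrN -big_split; apply: eq_bigr => l _ /=.
  by rewrite mulrBl qpE -(qpE l); ring.
have -> : \sum_(i < N | (i < j)%N) - (q i * p j * p i)
    = - (p j * \sum_(i < N | (i < j)%N) (k i + rho i)).
  rewrite mulr_sumr -sumrN; apply: eq_bigr => i _.
  by rewrite -qpE; ring.
have -> : (q j - 1) * p j + q' j * 0 - k j - rho j + q j * p j
   = k j + rho j - p j by rewrite mulrBl qpE; ring.
rewrite th1j; ring.
Qed.

Lemma dHam1_dp'_constrained j :
  derive1 (fun y : C => Ham1 th1 th2 th3 k0 k rho t1 t2
      q p q' (upd p' j y)) (p' j) =
  - q j * (- (\sum_(i < N) q' i * p i) + th2) / (t1 - t2)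
  - (\sum_(i < N) p i + th3) * (q j * q' j) / (t1 - 1)
  + q j * (\sum_(l < N | (j < l)%N) p l * (q' j - q' l)) / t1.
Proof.
rewrite dHam1_dp' /dHam1 sumB sumA_th1 H1S H1T H1C big1_eq.
have -> : \sum_(l < N | (j < l)%N) q j * p l * (q' j - q' l)
    = q j * \sum_(l < N | (j < l)%N) p l * (q' j - q' l).
  by rewrite mulr_sumr; apply: eq_bigr => l _; rewrite mulrA.
ring.
Qed.

(** With the primed and unprimed variables exchanged, each bracket is $q_ip_i-\kappa_i-\rho_i=0$, so
    the factors of the $(t_2-1)$-term of [Ham2] reduce to the constants $-\theta_3$ and
    $-\theta_2$. *)
Let H2S : sumS k rho q' p' q p = 0.
Proof. by rewrite /sumS big1 // => i _; rewrite qpE p'0; ring. Qed.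

Let H2T : sumT k rho q' p' q p = 0.
Proof. by rewrite /sumT big1 // => i _; rewrite qpE p'0; ring. Qed.

Lemma dHam2_dq_constrained j :
  derive1 (fun y : C => Ham2 th1 th2 th3 k0 k rho t1 t2
      (upd q j y) p q' p') (q j) =
  - p j * (- (\sum_(i < N) q' i * p i) + th2) / (t1 - t2)
  - p j * (th2 + th3 * q' j) / (t2 - 1).
Proof.
(* In [Ham2] the variable [q] occupies the slot of [q'], so the derivative in [q'] of [Ham1]
   applies. *)
rewrite /Ham2 dHam1_dq' /dHam1 sumB sumA_th1 H2S H2T p'0.
have -> : \sum_(l < N | (j < l)%N) q' j * p' l * p j = 0.
  by rewrite big1 // => l _; rewrite p'0; ring.
have -> : \sum_(i < N | (i < j)%N) - (q' i * 0 * p i) = 0.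
  by rewrite big1 // => i _; ring.
(* The exchange of times produces the denominator [t2 - t1]; its sign is moved out so that both
   sides share one inverse. *)
by rewrite -(opprB t1 t2) invrN; ring.
Qed.

(** Unlike for [Ham1], the first factor of the term over [t2] does not vanish: its sum is zero and
    $\theta_2$ remains, which multiplies the derivative $q'_j+q_j-1$ of the second factor. *)
Lemma dHam2_dp'_constrained j :
  derive1 (fun y : C => Ham2 th1 th2 th3 k0 k rho t1 t2
      q p q' (upd p' j y)) (p' j) =
  q j * (- (\sum_(i < N) q' i * p i) + th2) / (t1 - t2)
  - (q' j - 1) * (th2 + th3 * q' j) / (t2 - 1)
  + (k0 * q' j + th2 * (q' j + q j - 1) - k j * q' j
     - q j * \sum_(i < N | (i < j)%N) q' i * p i) / t2.
Proof.
rewrite /Ham2 dHam1_dp /dHam1 sumB sumA_th1 H2S H2T.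
have -> : sumC q' p' = 0.
  by rewrite /sumC big1 // => i _; rewrite p'0 mulr0.
have -> : sumF q' p' q = 0.
  by rewrite /sumF big1 // => i _; rewrite p'0 mulr0.
have -> : \sum_(l < N | (j < l)%N) q' j * p' l * (q' j - q' l) = 0.
  by rewrite big1 // => l _; rewrite p'0; ring.
have -> : \sum_(i < N | (i < j)%N)
      q' i * ((q' i - q' j) * p' i + (q i - q j) * p i - k i - rho i)
    = - (q j * \sum_(i < N | (i < j)%N) q' i * p i).
  rewrite mulr_sumr -sumrN; apply: eq_bigr => i _.
  by rewrite p'0 mulr0 mulrBl qpE; ring.
by rewrite -(opprB t1 t2) invrN; ring.
Qed.

End Constrained.
End Partials.

(** * Column vectors in the block coordinates $0$, $w_i$, $w'_i$ *)

Section Blocks.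
Variable R : realType.
Local Notation C := (R[i])^o.
Variable N : nat.
Implicit Types (i j : 'I_N) (c : 'I_N.*2.+1) (v : 'cV[C]_(N.*2.+1)).
Implicit Types (x : C) (y z : 'I_N -> C).

Lemma val_ixw i : ixw i = i.+1 :> nat.
Proof. by have := ltn_ord i; rewrite /ixw => iN; rewrite inordK //; lia. Qed.

Lemma val_ixw' i : ixw' i = (N + i.+1)%N :> nat.
Proof. by have := ltn_ord i; rewrite /ixw' => iN; rewrite inordK //; lia. Qed.

Lemma ixwI : injective (@ixw N).
Proof.
by move=> i j /(congr1 val) /=; rewrite !val_ixw => -[] /val_inj.
Qed.

Lemma ixw'I : injective (@ixw' N).
Proof.
by move=> i j /(congr1 val) /=; rewrite !val_ixw' => /addnI [] /val_inj.
Qed.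

Lemma ix0_ixw i : (ix0 N == ixw i) = false.
Proof. by rewrite -val_eqE /= val_ixw. Qed.

Lemma ix0_ixw' i : (ix0 N == ixw' i) = false.
Proof. by rewrite -val_eqE /= val_ixw' addnS. Qed.

Lemma ixw_ixw' i j : (ixw i == ixw' j) = false.
Proof. have := ltn_ord i; rewrite -val_eqE /= val_ixw val_ixw' => iN; lia. Qed.

Variant ix_spec : 'I_N.*2.+1 -> Prop :=
  | Ix0 : ix_spec (ix0 N)
  | Ixw i : ix_spec (ixw i)
  | Ixw' i : ix_spec (ixw' i).

Lemma ixP c : ix_spec c.
Proof.
case: (posnP c) => [c0|c_gt0].
  have -> : c = ix0 N by apply: val_inj.
  exact: Ix0.
have := ltn_ord c; case: (leqP c N) => cN c_lt.
  have h : (c.-1 < N)%N by lia.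
  have -> : c = ixw (Ordinal h).
    by apply: val_inj; rewrite /= val_ixw /=; lia.
  exact: Ixw.
have h : (c - N.+1 < N)%N by lia.
have -> : c = ixw' (Ordinal h).
  by apply: val_inj; rewrite /= val_ixw' /=; lia.
exact: Ixw'.
Qed.

(** The common shape of [wvec] and of the products of the five matrices with a vector; it lets the
    Pfaff system be compared block by block. *)
Definition blockcol x y z : 'cV[C]_(N.*2.+1) :=
  x *: delta_mx (ix0 N) 0 + \sum_(i < N) y i *: delta_mx (ixw i) 0
  + \sum_(i < N) z i *: delta_mx (ixw' i) 0.

Let sum_delta_entry (ix : 'I_N -> 'I_N.*2.+1) y c :
  (\sum_(i < N) y i *: delta_mx (ix i) 0 : 'cV[C]_(N.*2.+1)) c 0
  = \sum_(i < N) y i * (c == ix i)%:R.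
Proof. by rewrite summxE; apply: eq_bigr => i _; rewrite !mxE eqxx andbT. Qed.

Let sum_pick y j : \sum_(i < N) y i * (j == i)%:R = y j.
Proof.
rewrite (bigD1 j) //= eqxx mulr1 big1 ?addr0 // => i ij.
by rewrite eq_sym (negbTE ij) mulr0.
Qed.

Lemma blockcol0 x y z : blockcol x y z (ix0 N) 0 = x.
Proof.
rewrite 2!mxE !sum_delta_entry !mxE !eqxx mulr1 !big1 ?addr0 // => i _.
  by rewrite ix0_ixw' mulr0.
by rewrite ix0_ixw mulr0.
Qed.

Lemma blockcolw x y z j : blockcol x y z (ixw j) 0 = y j.
Proof.
rewrite 2!mxE !sum_delta_entry !mxE eq_sym ix0_ixw mulr0 add0r.
rewrite [X in _ + X]big1 ?addr0 => [|i _]; last by rewrite ixw_ixw' mulr0.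
by under eq_bigr do rewrite (inj_eq ixwI); rewrite sum_pick.
Qed.

Lemma blockcolw' x y z j : blockcol x y z (ixw' j) 0 = z j.
Proof.
rewrite 2!mxE !sum_delta_entry !mxE eq_sym ix0_ixw' mulr0 add0r.
rewrite big1 ?add0r => [|i _]; last by rewrite eq_sym ixw_ixw' mulr0.
by under eq_bigr do rewrite (inj_eq ixw'I); rewrite sum_pick.
Qed.

Lemma E_mul (a b : 'I_N.*2.+1) v : E R a b *m v = v b 0 *: delta_mx a 0.
Proof.
apply/matrixP => r s; rewrite ord1 !mxE (bigD1 b) //= !mxE !eqxx !andbT.
rewrite big1 ?addr0 1?mulrC // => l lb.
by rewrite !mxE (negbTE lb) andbF mul0r.
Qed.

Lemma sumE_mul (P : pred 'I_N) a (ix : 'I_N -> 'I_N.*2.+1) v :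
  (\sum_(j < N | P j) E R a (ix j)) *m v
  = (\sum_(j < N | P j) v (ix j) 0) *: delta_mx a 0.
Proof.
by rewrite mulmx_suml scaler_suml; apply: eq_bigr => j _; rewrite E_mul.
Qed.

End Blocks.

Arguments blockcol {R N}.

(** * Action of the five residue matrices on a vector *)

Section MatrixAction.
Variables (R : realType) (n : nat).
Local Notation C := (R[i])^o.
Variables (th2 th3 k0 : C) (k rho : 'I_n.+1 -> C).
Variables (v : 'cV[C]_(n.+1.*2.+1)).
Local Notation v0 := (v (ix0 n.+1) 0).
Local Notation vw j := (v (ixw j) 0).
Local Notation vw' j := (v (ixw' j) 0).

Let sum0 (ix : 'I_n.+1 -> 'I_n.+1.*2.+1) :
  \sum_(i < n.+1) (0 : C) *: delta_mx (ix i) 0 = 0 :> 'cV[C]_(n.+1.*2.+1).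
Proof. by rewrite big1 // => i _; rewrite scale0r. Qed.

(** All rows of [A11] are multiples of the single row $(\theta_3,1,\dots,1,0,\dots,0)$, so one
    linear form determines the whole product. The same holds for [At] with the row
    $(\theta_2,0,\dots,0,1,\dots,1)$. *)
Lemma A11_mul : A11 th3 k rho *m v =
  blockcol (th3 * v0 + \sum_(j < n.+1) vw j)
    (fun i => (k i + rho i) * (th3 * v0 + \sum_(j < n.+1) vw j)) (fun=> 0).
Proof.
rewrite /A11 /blockcol sum0 addr0 !mulmxDl -scalemxAl sumE_mul E_mul scalerA.
rewrite -scalerDl mulmx_suml; congr (_ + _); apply: eq_bigr => i _.
rewrite -scaler_sumr mulmxDl -!scalemxAl sumE_mul E_mul !scalerA -scalerDl.
by congr (_ *: _); ring.
Qed.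

Lemma A01_mul : A01 k0 k rho *m v =
  blockcol ((k0 + rho ord0) * v0 - \sum_(j < n.+1) vw j - \sum_(j < n.+1) vw' j)
    (fun i => (rho ord0 - rho i) * vw i
       - (k i + rho i) * \sum_(j < n.+1 | (i < j)%N) vw j)
    (fun i => (rho ord0 - rho i) * vw' i
       - (k i + rho i) * \sum_(j < n.+1 | (i < j)%N) vw' j).
Proof.
rewrite /A01 /blockcol !mulmxDl !mulNmx -scalemxAl !sumE_mul E_mul scalerA.
rewrite -!scalerBl !mulmx_suml; congr (_ + _ + _); apply: eq_bigr => i _.
  by rewrite -scaler_sumr mulmxBl -!scalemxAl sumE_mul E_mul !scalerA -scalerBl.
by rewrite -scaler_sumr mulmxBl -!scalemxAl sumE_mul E_mul !scalerA -scalerBl.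
Qed.

Lemma At_mul : At th2 k rho *m v =
  blockcol (th2 * v0 + \sum_(j < n.+1) vw' j) (fun=> 0)
    (fun i => (k i + rho i) * (th2 * v0 + \sum_(j < n.+1) vw' j)).
Proof.
rewrite /At /blockcol sum0 addr0 !mulmxDl -scalemxAl sumE_mul E_mul scalerA.
rewrite -scalerDl mulmx_suml; congr (_ + _); apply: eq_bigr => i _.
rewrite -scaler_sumr mulmxDl -!scalemxAl sumE_mul E_mul !scalerA -scalerDl.
by congr (_ *: _); ring.
Qed.

Lemma A12_mul : A12 n th2 th3 *m v =
  blockcol 0 (fun i => th2 * vw i - th3 * vw' i)
    (fun i => - th2 * vw i + th3 * vw' i).
Proof.
rewrite /A12 /blockcol scale0r add0r mulmxDl !mulmx_suml.
congr (_ + _); apply: eq_bigr => i _.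
  by rewrite mulmxBl -!scalemxAl !E_mul !scalerA -scalerBl.
by rewrite mulmxDl -!scalemxAl !E_mul !scalerA -scalerDl.
Qed.

Lemma A02_mul : A02 th2 k0 k rho *m v =
  blockcol 0 (fun=> 0)
    (fun i => - (th2 * (k i + rho i)) * v0 + th2 * vw i
       - (k i + rho i) * \sum_(j < n.+1 | (j < i)%N) vw' j
       + (th2 + k0 - k i) * vw' i).
Proof.
rewrite /A02 /blockcol sum0 scale0r !add0r mulmx_suml.
apply: eq_bigr => i _; rewrite -scaler_sumr !mulmxDl mulNmx -!scalemxAl.
by rewrite sumE_mul !E_mul !scalerA -!scalerDl -scalerBl -scalerDl.
Qed.

End MatrixAction.

(** * Assembly of the Pfaff system *)

Lemma wvecE (R : realType) N (w0 : R[i]^o -> R[i]^o -> R[i]^o)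
    (p q' : 'I_N -> R[i]^o -> R[i]^o -> R[i]^o) t1 t2 :
  wvec w0 p q' t1 t2 = blockcol (w0 t1 t2) (fun i => w0 t1 t2 * p i t1 t2)
    (fun i => - (w0 t1 t2 * (q' i t1 t2 * p i t1 t2))).
Proof.
rewrite /wvec /blockcol !scalerDr !scaler_sumr.
congr (_ + _ + _); apply: eq_bigr => i _; rewrite scalerA //.
by rewrite mulrN.
Qed.

Lemma derivable_is_derive1 {K : numFieldType} {f : K^o -> K^o} {x : K^o} :
  derivable f x 1 -> is_derive x 1 f (derive1 f x).
Proof. by rewrite derive1E => /derivableP. Qed.

Lemma is_derive_derive1 {K : numFieldType} {f : K^o -> K^o} {x df : K^o} :
  is_derive x 1 f df -> derive1 f x = df.
Proof. by move=> fdf; rewrite derive1E derive_val. Qed.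

Lemma mulmx_lin3 {R : realType} {N} {x y z : (R[i])^o}
    {A B D : 'M[(R[i])^o]_N} {v cA cB cD : 'cV[(R[i])^o]_N} {a} :
  A *m v = cA -> B *m v = cB -> D *m v = cD ->
  ((x *: A + y *: B + z *: D) *m v) a 0
  = x * cA a 0 + y * cB a 0 + z * cD a 0.
Proof. by move=> <- <- <-; rewrite !mulmxDl -!scalemxAl !mxE. Qed.

(* Otherwise unification unfolds the matrices when comparing them. *)
Local Opaque A11 A01 At A12 A02 blockcol.

Theorem theorem3p2 (R : realType) (n : nat)
  (th1 th2 th3 k0 : (R[i])^o) (k rho : 'I_n.+1 -> (R[i])^o)
  (U : set ((R[i])^o * (R[i])^o))
  (q p q' p' : 'I_n.+1 -> (R[i])^o -> (R[i])^o -> (R[i])^o)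
  (w0 : (R[i])^o -> (R[i])^o -> (R[i])^o) :
  open U ->
  (forall t1 t2, U (t1, t2) ->
     [/\ t1 != 0, t1 != 1, t2 != 0, t2 != 1 & t1 != t2]) ->
  (* the unknowns are (partially) holomorphic on U *)
  (forall t1 t2 j, U (t1, t2) ->
     [/\ pderivable (q j) t1 t2, pderivable (p j) t1 t2,
         pderivable (q' j) t1 t2 & pderivable (p' j) t1 t2]) ->
  (* the Schlesinger-Tsuda system H_{n+1,2} *)
  (forall t1 t2 j, U (t1, t2) ->
     let H1 := @Ham1 R n.+1 th1 th2 th3 k0 k rho t1 t2 in
     let H2 := @Ham2 R n.+1 th1 th2 th3 k0 k rho t1 t2 in
     let Q := atv q t1 t2 in let P := atv p t1 t2 in
     let Q' := atv q' t1 t2 in let P' := atv p' t1 t2 in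
     [/\ d1 (q j) t1 t2 = dHdp H1 Q P Q' P' j,
         d1 (p j) t1 t2 = - dHdq H1 Q P Q' P' j,
         d1 (q' j) t1 t2 = dHdp' H1 Q P Q' P' j &
         d1 (p' j) t1 t2 = - dHdq' H1 Q P Q' P' j] /\
     [/\ d2 (q j) t1 t2 = dHdp H2 Q P Q' P' j,
         d2 (p j) t1 t2 = - dHdq H2 Q P Q' P' j,
         d2 (q' j) t1 t2 = dHdp' H2 Q P Q' P' j &
         d2 (p' j) t1 t2 = - dHdq' H2 Q P Q' P' j]) ->
  (* the additional constraints *)
  (forall t1 t2 j, U (t1, t2) ->
     q j t1 t2 * p j t1 t2 - k j - rho j = 0 /\ p' j t1 t2 = 0) ->
  th1 + \sum_(j < n.+1) (k j + rho j) = 0 ->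
  (* w0 : nonvanishing, with prescribed logarithmic differential *)
  (forall t1 t2, U (t1, t2) ->
     [/\ w0 t1 t2 != 0, pderivable w0 t1 t2,
         d1 w0 t1 t2 = w0 t1 t2 *
           ((\sum_(j < n.+1) p j t1 t2 + th3) / (t1 - 1)
            + (\sum_(j < n.+1) (q' j t1 t2 - 1) * p j t1 t2 + k0 + rho ord0) / t1
            + (- \sum_(j < n.+1) q' j t1 t2 * p j t1 t2 + th2) / (t1 - t2)) &
         d2 w0 t1 t2 = w0 t1 t2 *
           ((- \sum_(j < n.+1) q' j t1 t2 * p j t1 t2 + th2) * (- (t1 - t2)^-1))]) ->
  (* conclusion: the linear Pfaff system *)
  forall t1 t2 (a : 'I_(n.+1.*2.+1)), U (t1, t2) ->
    let w := wvec w0 p q' in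
    let wa := fun s u => w s u a 0 in
    [/\ pderivable wa t1 t2,
        d1 wa t1 t2 =
          (((t1 - 1)^-1 *: @A11 R n th3 k rho
            + t1^-1 *: @A01 R n k0 k rho
            + (t1 - t2)^-1 *: @At R n th2 k rho) *m w t1 t2) a 0 &
        d2 wa t1 t2 =
          ((- (t1 - t2)^-1 *: @At R n th2 k rho
            + (t2 - 1)^-1 *: @A12 R n th2 th3
            + t2^-1 *: @A02 R n th2 k0 k rho) *m w t1 t2) a 0].
Proof.
move=> _ _ Ureg Uham Ucon th1E Uw0 t1 t2 a Ut w wa.
have {Uw0}[_ [w0d1 w0d2] dw0 d'w0] := Uw0 _ _ Ut.
pose Q := atv q t1 t2; pose P := atv p t1 t2.
pose Q' := atv q' t1 t2; pose P' := atv p' t1 t2.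
have qpE i : Q i * P i = k i + rho i.
  by have [/eqP + _] := Ucon _ _ i Ut; rewrite -addrA -opprD subr_eq0 => /eqP.
have p'0 i : P' i = 0 by have [] := Ucon _ _ i Ut.
pose W := w0 t1 t2.
pose SP := \sum_(i < n.+1) P i; pose SQ := \sum_(i < n.+1) Q' i * P i.
have SQP : \sum_(i < n.+1) (Q' i - 1) * P i = SQ - SP.
  by rewrite -sumrB; apply: eq_bigr => i _; rewrite mulrBl mul1r.
(* The components of [w] are built from [w0], [p i] and [q' i]; the next four facts evaluate the
   system for [p i] and [q' i] in both times. *)
have dp i : d1 (p i) t1 t2 =
    - (P i * (- SQ + th2) / (t1 - t2)
       + (SP + th3) * (P i - (k i + rho i)) / (t1 - 1)
       + (P i * (SQ - SP + k0 + rho i)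
          + (k i + rho i) * \sum_(l < n.+1 | (i < l)%N) P l) / t1).
  have [[_ -> _ _] _] := Uham _ _ i Ut.
  by rewrite /dHdq dHam1_dq_constrained // SQP.
have d'p i : d2 (p i) t1 t2 =
    - (- P i * (- SQ + th2) / (t1 - t2) - P i * (th2 + th3 * Q' i) / (t2 - 1)).
  have [_ [_ -> _ _]] := Uham _ _ i Ut.
  by rewrite /dHdq dHam2_dq_constrained //.
have dq' i : d1 (q' i) t1 t2 =
    - Q i * (- SQ + th2) / (t1 - t2) - (SP + th3) * (Q i * Q' i) / (t1 - 1)
    + Q i * (\sum_(l < n.+1 | (i < l)%N) P l * (Q' i - Q' l)) / t1.
  have [[_ _ -> _] _] := Uham _ _ i Ut.
  by rewrite /dHdp' dHam1_dp'_constrained //.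
have d'q' i : d2 (q' i) t1 t2 =
    Q i * (- SQ + th2) / (t1 - t2) - (Q' i - 1) * (th2 + th3 * Q' i) / (t2 - 1)
    + (k0 * Q' i + th2 * (Q' i + Q i - 1) - k i * Q' i
       - Q i * \sum_(l < n.+1 | (l < i)%N) Q' l * P l) / t2.
  have [_ [_ _ -> _]] := Uham _ _ i Ut.
  by rewrite /dHdp' dHam2_dp'_constrained //.
have f0 : (fun s u => w s u (ix0 _) 0) = w0.
  by apply/funext => s; apply/funext => u; rewrite /w wvecE blockcol0.
have fw i : (fun s u => w s u (ixw i) 0) = (fun s u => w0 s u * p i s u).
  by apply/funext => s; apply/funext => u; rewrite /w wvecE blockcolw.
have fw' i : (fun s u => w s u (ixw' i) 0)
    = (fun s u => - (w0 s u * (q' i s u * p i s u))).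
  by apply/funext => s; apply/funext => u; rewrite /w wvecE blockcolw'.
have v0 : w t1 t2 (ix0 _) 0 = W by rewrite (congr1 (fun f => f t1 t2) f0).
have vw i : w t1 t2 (ixw i) 0 = W * P i
  by rewrite (congr1 (fun f => f t1 t2) (fw i)).
have vw' i : w t1 t2 (ixw' i) 0 = - (W * (Q' i * P i)).
  by rewrite (congr1 (fun f => f t1 t2) (fw' i)).
have sumw (F : pred 'I_n.+1) : \sum_(i < n.+1 | F i) w t1 t2 (ixw i) 0
    = W * \sum_(i < n.+1 | F i) P i.
  by rewrite mulr_sumr; apply: eq_bigr => i _; rewrite vw.
have sumw' (F : pred 'I_n.+1) : \sum_(i < n.+1 | F i) w t1 t2 (ixw' i) 0
    = - (W * \sum_(i < n.+1 | F i) Q' i * P i).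
  by rewrite mulr_sumr -sumrN; apply: eq_bigr => i _; rewrite vw'.
have {}dw0 : d1 w0 t1 t2 = W * ((SP + th3) / (t1 - 1)
    + (SQ - SP + k0 + rho ord0) / t1 + (- SQ + th2) / (t1 - t2)).
  by rewrite dw0 -SQP.
have {}d'w0 : d2 w0 t1 t2 = W * ((- SQ + th2) * (- (t1 - t2)^-1)) by [].
rewrite {}/wa; clearbody w.
rewrite (mulmx_lin3 (A11_mul _ _ th3 k rho (w t1 t2))
  (A01_mul _ _ k0 k rho (w t1 t2)) (At_mul _ _ th2 k rho (w t1 t2))).
rewrite (mulmx_lin3 (At_mul _ _ th2 k rho (w t1 t2))
  (A12_mul _ _ th2 th3 (w t1 t2)) (A02_mul _ _ th2 k0 k rho (w t1 t2))).
case: a / (ixP _ a) => [|i|i].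
(* Row $0$ is the prescribed $d\log w_0$ multiplied by [W]. *)
- rewrite !blockcol0 !sumw !sumw' v0.
  rewrite f0; split; first by split.
    by rewrite dw0 -/SP -/SQ; ring.
  by rewrite d'w0 -/SP -/SQ; ring.
(* Row $w_i$: the poles along $t_1=t_2$ cancel between $p_i\,dw_0$ and $w_0\,dp_i$. At $t_1=0$ the
   diagonal residue is the difference of [rho ord0], from [w0], and [rho i], from [p i]. *)
- rewrite !blockcolw !sumw v0 !vw !vw' -/SP -/SQ fw.
  have [_ [pd1 pd2] _ _] := Ureg _ _ i Ut.
  have D1 := is_derive_mulf (derivable_is_derive1 w0d1)
    (derivable_is_derive1 pd1).
  have D2 := is_derive_mulf (derivable_is_derive1 w0d2)
    (derivable_is_derive1 pd2).
  split; first by split; [case: D1|case: D2].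
    rewrite /d1 (is_derive_derive1 D1) -!/(d1 _ _ _) dw0 dp.
    rewrite -/W -[p i t1 t2]/(P i).
    ring.
  rewrite /d2 (is_derive_derive1 D2) -!/(d2 _ _ _) d'w0 d'p.
  rewrite -/W -[p i t1 t2]/(P i).
  ring.
- rewrite !blockcolw' !sumw' v0 !vw !vw' -/SP -/SQ fw'.
  have [_ [pd1 pd2] [q'd1 q'd2] _] := Ureg _ _ i Ut.
  have D1 := is_derive_oppf (is_derive_mulf (derivable_is_derive1 w0d1)
    (is_derive_mulf (derivable_is_derive1 q'd1) (derivable_is_derive1 pd1))).
  have D2 := is_derive_oppf (is_derive_mulf (derivable_is_derive1 w0d2)
    (is_derive_mulf (derivable_is_derive1 q'd2) (derivable_is_derive1 pd2))).
  (* The term $p_i\,dq'_i$ brings in products $q_ip_i$ where the matrices have $\kappa_i+\rho_i$;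
     eliminating [k i] turns the goals into identities for [ring]. *)
  have kE : k i = Q i * P i - rho i by rewrite qpE addrK.
  split; first by split; [case: D1|case: D2].
    rewrite /d1 (is_derive_derive1 D1) -!/(d1 _ _ _) dw0 dp dq'.
    rewrite -/W -[p i t1 t2]/(P i) -[q' i t1 t2]/(Q' i).
    (* The first part cancels against the tail sum in $q'_i\,\partial_{t_1}p_i$; the second consists
       of the entries $w'_l$ up to the factor [- W]. *)
    have -> : \sum_(l < n.+1 | (i < l)%N) P l * (Q' i - Q' l)
        = Q' i * \sum_(l < n.+1 | (i < l)%N) P l
          - \sum_(l < n.+1 | (i < l)%N) Q' l * P l.
      by rewrite mulr_sumr -sumrB; apply: eq_bigr => l _; ring.
    rewrite kE; ring.
  (* At $t_2=1$ the terms with $q'_i(\theta_2+\theta_3q'_i)$ cancel between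
     $q'_i\,\partial_{t_2}p_i$ and $p_i\,\partial_{t_2}q'_i$, leaving the negative of the residue in
     row $w_i$. *)
  rewrite /d2 (is_derive_derive1 D2) -!/(d2 _ _ _) d'w0 d'p d'q'.
  rewrite -/W -[p i t1 t2]/(P i) -[q' i t1 t2]/(Q' i).
  rewrite kE; ring.
Qed.
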